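(* Every finitely generated acylindrically hyperbolic group $G$ possesses a linearly bounded relative ambiguity function (of $G$ in $G$, i.e. a linearly bounded ambiguity function of $G$).
   Context: $\mathbb{N}$ contains $0$. For a group $G$ with finite generating set $X$, $|g|_X$ denotes word length with respect to $X\cup X^{-1}$; for a subgroup $H\le G$ and $r\in\mathbb{N}$, $B_H^X(r)=\{h\in H:|h|_X\le r\}$. Let $G$ be a group with finite generating set $X$ and $H\le G$ a subgroup. A function $\Phi\colon H\times H\to H$ is a concatenation map of $H$ in $G$ if there is a constant $\varepsilon\in\mathbb{N}$ such that for all $h,k\in H$ one has $\Phi(h,k)=h\,x_{h,k}\,k$ with $x_{h,k}\in B_H^X(\varepsilon)$. For $m,n\in\mathbb{N}$ let $\Phi_{m,n}$ be the restriction of $\Phi$ to $B_H^X(m)\times B_H^X(n)$. A function $f\colon\mathbb{N}\to\mathbb{N}$ is a relative ambiguity function for $\Phi$ (and of $H$ in $G$, with respect to $X$) if $|\Phi_{m,n}^{-1}(g)|\le f(n)$ for all $m,n\in\mathbb{N}$ and all $g\in H$. If $H=G$, $f$ is called an ambiguity function of $G$. Up to precomposing $f$ with multiplication by a constant, this does not depend on $X$. ''Linearly bounded'' means bounded above by a function $n\mapsto an+b$ with constants $a,b\geq 0$; existence of such an $f$ is independent of $X$. A hyperbolic space is a geodesic metric space that is Gromov hyperbolic. An action of a group $G$ by isometries on a metric space $(\Omega,d)$ is acylindrical if for every $\varepsilon>0$ there are constants $R,N>0$ such that for all $x,y\in\Omega$ with $d(x,y)\ge R$ there are at most $N$ elements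 $g\in G$ with $d(x,gx)\le\varepsilon$ and $d(y,gy)\le\varepsilon$. For an action on a hyperbolic space $\Omega$, an element $g$ is loxodromic if $\mathbb{Z}\to\Omega$, $n\mapsto g^n x$, is a quasigeodesic for some (equivalently any) $x$. An acylindrical action of $G$ on a hyperbolic space is elementary if $G$ has bounded orbits, or $G$ is virtually cyclic and contains a loxodromic element; otherwise it is non-elementary. $G$ is acylindrically hyperbolic if it admits a non-elementary acylindrical action on a hyperbolic space. *)

(* Defs.v *)
From mathcomp Require Import all_boot all_order all_algebra.
From mathcomp Require Import all_classical all_reals all_analysis.

Set Implicit Arguments.
Unset Strict Implicit.
Unset Printing Implicit Defensive.

Import Order.TTheory GRing.Theory Num.Theory.

Local Open Scope classical_set_scope.
Local Open Scope card_scope.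
Local Open Scope ring_scope.

Definition is_subgroup (G : groupType) (H : set G) : Prop :=
  [/\ H 1%g, (forall x y, H x -> H y -> H (x * y)%g) &
      (forall x, H x -> H (x^-1)%g)].

Definition generates (G : groupType) (X : set G) : Prop :=
  smallest (@is_subgroup G) X = [set: G].

Definition expgz (G : groupType) (g : G) (n : int) : G :=
  match n with
  | Posz m => (g ^+ m)%g
  | Negz m => (g ^- m.+1)%g
  end.

Definition virtually_cyclic (G : groupType) : Prop :=
  exists c : G,
    finite_set (range (fun g : G => [set (g * h)%g | h in range (expgz c)])).

Definition is_word (G : groupType) (X : set G) (w : seq G) : Prop :=
  forall x, x \in w -> X x \/ X (x^-1)%g.

Definition word_lengths (G : groupType) (X : set G) (g : G) : set nat :=
  [set n | exists w : seq G,
     [/\ is_word X w, size w = n & (\prod_(x <- w) x)%g = g]].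

(* The default value 0 is only reached when [g] is outside the subgroup
   generated by [X]. *)
Definition word_length (G : groupType) (X : set G) (g : G) : nat :=
  xget 0%N [set n | word_lengths X g n /\
                    forall m, word_lengths X g m -> (n <= m)%N].

Definition word_ball (G : groupType) (X H : set G) (r : nat) : set G :=
  [set h | H h /\ (word_length X h <= r)%N].

(* A map H x H -> H is encoded by a total function G -> G -> G of which only
   the values on H x H matter; these lie in H when H is a subgroup. *)
Definition concatenation_map (G : groupType) (X H : set G)
    (Phi : G -> G -> G) : Prop :=
  exists eps : nat, forall h k, H h -> H k ->
    exists2 x, word_ball X H eps x & Phi h k = (h * x * k)%g.

Definition fiber (G : groupType) (X H : set G) (Phi : G -> G -> G)
    (m n : nat) (g : G) : set (G * G) :=
  [set p | [/\ word_ball X H m p.1, word_ball X H n p.2 & Phi p.1 p.2 = g]].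

Definition ambiguity_function_for (G : groupType) (X H : set G)
    (Phi : G -> G -> G) (f : nat -> nat) : Prop :=
  forall (m n : nat) (g : G), H g -> fiber X H Phi m n g #<= `I_(f n).

Definition relative_ambiguity_function (G : groupType) (X H : set G)
    (f : nat -> nat) : Prop :=
  exists2 Phi : G -> G -> G,
    concatenation_map X H Phi & ambiguity_function_for X H Phi f.

Definition ambiguity_function (G : groupType) (X : set G) (f : nat -> nat) :
  Prop := relative_ambiguity_function X [set: G] f.

Definition linearly_bounded (R : realType) (f : nat -> nat) : Prop :=
  exists a b : R, [/\ 0 <= a, 0 <= b & forall n, (f n)%:R <= a * n%:R + b].

Definition geodesic_space (R : realType) (Omega : metricType R) : Prop :=
  forall x y : Omega, exists gamma : R -> Omega,
    [/\ gamma 0 = x, gamma (mdist x y) = y &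
        forall s t, 0 <= s <= mdist x y -> 0 <= t <= mdist x y ->
          mdist (gamma s) (gamma t) = `|s - t|].

Definition gromov_product (R : realType) (Omega : metricType R)
    (w x y : Omega) : R :=
  (mdist x w + mdist y w - mdist x y) / 2.

Definition gromov_hyperbolic (R : realType) (Omega : metricType R) : Prop :=
  exists delta : R, forall w x y z : Omega,
    Num.min (gromov_product w x y) (gromov_product w y z) - delta
      <= gromov_product w x z.

Definition hyperbolic_space (R : realType) (Omega : metricType R) : Prop :=
  geodesic_space Omega /\ gromov_hyperbolic Omega.

Definition isometric_action (R : realType) (G : groupType)
    (Omega : metricType R) (act : G -> Omega -> Omega) : Prop :=
  [/\ (forall x, act 1%g x = x),
      (forall g h x, act (g * h)%g x = act g (act h x)) &
      (forall g x y, mdist (act g x) (act g y) = mdist x y)].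

Definition acylindrical (R : realType) (G : groupType)
    (Omega : metricType R) (act : G -> Omega -> Omega) : Prop :=
  forall eps : R, 0 < eps ->
    exists (r : R) (N : nat), [/\ 0 < r, (0 < N)%N &
      forall x y : Omega, r <= mdist x y ->
        [set g : G | mdist x (act g x) <= eps /\ mdist y (act g y) <= eps]
          #<= `I_N].

Definition quasigeodesic (R : realType) (Omega : metricType R)
    (q : int -> Omega) : Prop :=
  exists lambda c : R, [/\ 1 <= lambda, 0 <= c &
    forall m n : int,
      lambda^-1 * `|m - n|%:~R - c <= mdist (q m) (q n)
        <= lambda * `|m - n|%:~R + c].

Definition loxodromic (R : realType) (G : groupType)
    (Omega : metricType R) (act : G -> Omega -> Omega) (g : G) : Prop :=
  exists x : Omega, quasigeodesic (fun n : int => act (expgz g n) x).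

Definition bounded_orbits (R : realType) (G : groupType)
    (Omega : metricType R) (act : G -> Omega -> Omega) : Prop :=
  forall x : Omega, exists M : R, forall g h : G,
    mdist (act g x) (act h x) <= M.

Definition elementary (R : realType) (G : groupType)
    (Omega : metricType R) (act : G -> Omega -> Omega) : Prop :=
  bounded_orbits act \/
  (virtually_cyclic G /\ exists g : G, loxodromic act g).

Definition acylindrically_hyperbolic (R : realType) (G : groupType) : Prop :=
  exists (Omega : metricType R) (act : G -> Omega -> Omega),
    [/\ hyperbolic_space Omega, isometric_action act, acylindrical act &
        ~ elementary act].

(* Main.v *)
Require Import Defs.
From mathcomp Require Import all_boot all_order all_algebra.
From mathcomp Require Import all_classical all_reals all_analysis.
From mathcomp Require Import finmap zify lra.

(** Fix a base point of the hyperbolic space and measure lengths of group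
elements by displacement of that point: |g| is the distance from the base point
to its image, and (g|h) is the Gromov product of the two images seen from it.

The concatenation map inserts between h and k one of three long elements x_i,
chosen so that the path 1, h, h x_i, h x_i k turns little: (h^-1|x_i) <= C and
(x_i^-1|k) <= C. Since x_i is long compared with C, hyperbolicity makes h and
h x_i lie near any geodesic from 1 to the product g = h x_i k. The position of
h along that geodesic is at distance |x_i k| from the end g, and this takes
O(n) values up to error 1 when k has word length at most n, whatever the
length of h. If h and h' lead to the same g with the same connector and the same
position, then h' h^-1 moves both h and h x_i by a bounded amount, so by
acylindricity there are boundedly many such h' as soon as |x_i| exceeds the
acylindricity radius; and k is determined by g, h and x_i. This count is
[connectors_linear_ambiguity].

It is essential that C is fixed before the length of the connectors. Three
elements f^n, f^-n and g f^n g^-1 do this when f is loxodromic and g moves both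
ends of its axis off themselves: the pairwise Gromov products of their forward
ends, and of their backward ends, are bounded independently of n, so a given
direction is close to at most one of the three ([three_connectors]).

Such an f exists because an action without loxodromic elements behaves like a
parabolic one: all elements share the first half of their geodesics, hence
finitely many prescribed elements move a whole long segment by a bounded amount,
which acylindricity forbids ([exists_doubling]).
Such a g exists because otherwise each g carries the axis of f along itself for
arbitrarily long, acylindricity gives g f^p g^-1 = f^(p or -p) with p bounded
independently of g, a fixed power of f generates a normal subgroup, and every
element lies boundedly close to it, so that G is virtually cyclic
([axial_commensurate], [normalized_axis_virtually_cyclic],
[independent_translate]). *)

Import Order.TTheory GRing.Theory Num.Theory.
Local Open Scope classical_set_scope.

(** * Counting with duplicate-free sequences *)
Section Counting.
Set Implicit Arguments.
Unset Strict Implicit.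
Unset Printing Implicit Defensive.
Local Open Scope card_scope.

(** Cardinal bounds are exchanged for bounds on the sizes of duplicate-free
    sequences here and in [uniq_card_le]: pigeonhole arguments then become
    counts in a sequence, with no finiteness to establish beforehand. *)
Lemma card_le_uniq (T : choiceType) (A : set T) (n : nat) (s : seq T) :
  A #<= `I_n -> uniq s -> (forall x, x \in s -> A x) -> (size s <= n)%N.
Proof.
move=> An us sA.
have /card_leP[f] : [set` s] #<= `I_n by apply: card_le_trans An; exact: subset_card_le.
have := @card_le_II (size s) n.
suff -> : `I_(size s) #<= `I_n by [].
apply: card_le_trans (_ : [set` s] #<= _); last by apply/card_leP; squash f.
have -> : [set` s] = [set` [fset x in s]%fset].
  by apply/seteqP; split=> x /=; rewrite !inE.
have /card_eq_fsetP : #|` [fset x in s]%fset| = size s.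
  by rewrite card_fseq undup_id.
by rewrite card_eq_le => /andP[].
Qed.

Lemma uniq_card_le (T : choiceType) (A : set T) (n : nat) :
  (forall s : seq T, uniq s -> (forall x, x \in s -> A x) -> (size s <= n)%N) ->
  A #<= `I_n.
Proof.
move=> H.
have finA : finite_set A.
  apply: contrapT => /(@infinite_set_fset _ _ n.+1)[B BA].
  by rewrite ltnNge H// => x xB; exact: BA.
case/finite_fsetP: finA => B AB.
have /card_eq_fsetP : #|` B| = #|` B| by [].
rewrite -AB card_eq_le => /andP[AI _]; apply: card_le_trans AI _.
by rewrite card_le_II H// => x; rewrite AB.
Qed.

Lemma size_le_classes (T : eqType) (C : finType) (c : T -> C) (b : nat) (s : seq T) :
  (forall i, (count (fun x => c x == i) s <= b)%N) -> (size s <= #|C| * b)%N.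
Proof.
move=> H.
have -> : size s = (\sum_(i : C) count (fun x => c x == i) s)%N.
  elim: s {H} => [|x s IH] /=; first by rewrite big1.
  rewrite big_split /= -IH (bigD1 (c x)) //= eqxx big1 // => i /negPf.
  by rewrite eq_sym => ->.
by rewrite -sum_nat_const; apply: leq_sum => i _; exact: H.
Qed.

Lemma avoid_two (i j : 'I_3) : exists k, k != i /\ k != j.
Proof.
apply: contrapT => H; have : (#|'I_3| <= #|[:: i; j]|)%N.
  apply: subset_leq_card; apply/fintype.subsetP => k _; rewrite !inE.
  by apply: contrapT => /negP; rewrite negb_or => /andP[ki kj]; apply: H; exists k.
by rewrite card_ord leqNgt ltnS card_size.
Qed.

End Counting.

(** * Real-valued functions *)
Section RealTools.
Set Implicit Arguments.
Unset Strict Implicit.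
Unset Printing Implicit Defensive.
Local Open Scope ring_scope.
Context {R : realType}.

Lemma discrete_ivt (F : nat -> R) i0 n v : (i0 <= n)%N -> F i0 <= v -> v < F n ->
  exists2 i, (i0 <= i < n)%N & F i <= v < F i.+1.
Proof.
move=> + F0; elim: n => [|n IH].
  by rewrite leqn0 => /eqP <- Fn; move: (le_lt_trans F0 Fn); rewrite ltxx.
rewrite leq_eqVlt => /predU1P[<- Fn|]; first by move: (le_lt_trans F0 Fn); rewrite ltxx.
rewrite ltnS => i0n Fn; have [vFn|Fnv] := ltP v (F n).
  by have [i /andP[i0i iN] Hi] := IH i0n vFn; exists i; rewrite ?i0i ?ltnS ?(ltnW iN).
by exists n; [rewrite i0n ltnSn | rewrite Fnv].
Qed.

Lemma nat_gt (x : R) : exists n : nat, x < n%:R.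
Proof.
exists (Num.bound (Num.max 0 x)); apply: le_lt_trans (archi_boundP _).
  by rewrite le_max lexx orbT.
by rewrite le_max lexx.
Qed.

(** Used for lengths over infinitely many group elements, where an exact
    minimum need not exist. *)
Lemma approx_minimizer (T : Type) (phi : T -> R) (t0 : T) :
  (forall t, 0 <= phi t) -> exists t, forall t', phi t <= phi t' + 1.
Proof.
move=> phi0; have hinf : has_inf (range phi).
  by split; [exists (phi t0); exists t0 | exists 0 => _ [t _ <-]].
have [_ [t _ <-] tinf] := inf_adherent (@ltr01 R) hinf.
exists t => t'; apply: le_trans (ltW tinf) _; rewrite lerD2r.
by apply: ge_inf; [exact: hinf.2 | exists t'].
Qed.

End RealTools.

(** * Powers and cosets of a cyclic subgroup *)
Section CyclicCosets.
Set Implicit Arguments.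
Unset Strict Implicit.
Unset Printing Implicit Defensive.
Context {G : groupType}.

(** Quotients of natural powers avoid the case distinction on the signs of two
    integer exponents when powers are multiplied. *)
Lemma range_expgzP (c h : G) :
  range (expgz c) h <-> exists m n, h = (c ^+ m * c ^- n)%g.
Proof.
split=> [[[m|m] _ <-]|[m [n ->]]] /=.
- by exists m, 0; rewrite expg0 invg1 mulg1.
- by exists 0, m.+1; rewrite expg0 mul1g.
have [nm|mn] := leqP n m; first by exists (Posz (m - n)) => //=; rewrite expgnFr.
exists (Negz (n - m).-1) => //=; rewrite prednK ?subn_gt0//.
by rewrite (expgnFr c (ltnW mn)) invgF.
Qed.

Lemma range_expgzM (c x y : G) :
  range (expgz c) x -> range (expgz c) y -> range (expgz c) (x * y)%g.
Proof.
move=> /range_expgzP[m [n ->]] /range_expgzP[p [q ->]]; apply/range_expgzP.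
have com : (c ^- n * c ^+ p = c ^+ p * c ^- n)%g by symmetry; apply/commuteV/commuteX2.
by exists (m + p)%N, (q + n)%N; rewrite !expgnDr invgM !mulgA -(mulgA (c ^+ m)%g) com !mulgA.
Qed.

Lemma range_expgzV (c x : G) : range (expgz c) x -> range (expgz c) x^-1%g.
Proof. by move=> /range_expgzP[m [n ->]]; apply/range_expgzP; exists n, m; rewrite invgF. Qed.

Lemma cyclic_cosetM (c g z : G) : range (expgz c) z ->
  [set (g * z * h)%g | h in range (expgz c)] = [set (g * h)%g | h in range (expgz c)].
Proof.
move=> cz; apply/seteqP; split=> _ [h ch <-].
  by exists (z * h)%g; [exact: range_expgzM | rewrite mulgA].
exists (z^-1 * h)%g; first exact: range_expgzM (range_expgzV cz) ch.
by rewrite mulgA mulgK.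
Qed.

Lemma expg_intertwine (g x y : G) n : (g * x = y * g -> g * x ^+ n = y ^+ n * g)%g.
Proof.
move=> E; elim: n => [|n IH]; first by rewrite !expg0 mulg1 mul1g.
by rewrite expgSr mulgA IH -mulgA E mulgA -expgSr.
Qed.

End CyclicCosets.

(** * Word length *)
Section Words.
Set Implicit Arguments.
Unset Strict Implicit.
Unset Printing Implicit Defensive.
Local Open Scope ring_scope.
Context {G : groupType} (X : set G).

(** The products of words form a subgroup containing X. *)
Lemma exists_word (g : G) : generates X -> exists n, word_lengths X g n.
Proof.
move=> genX; have : [set: G] g by [].
rewrite -genX; suff sub : smallest (@is_subgroup G) X `<=` [set h | exists n, word_lengths X h n].
  exact: sub.
apply: smallest_sub => [|x Xx]; last first.
  exists 1, [:: x]; split=> //; last by rewrite big_seq1.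
  by move=> y; rewrite inE => /eqP ->; left.
split.
- by exists 0, [::]; split=> //; rewrite big_nil.
- move=> x y [m [v [Wv _ <-]]] [n [w [Ww _ <-]]].
  exists (size (v ++ w)), (v ++ w); split=> //; last by rewrite big_cat.
  by move=> z; rewrite mem_cat => /orP[/Wv|/Ww].
move=> x [m [v [Wv _ <-]]].
exists (size (rev [seq z^-1 | z <- v]%g)), (rev [seq z^-1 | z <- v]%g); split=> //.
  move=> z; rewrite mem_rev => /mapP[y /Wv yX ->]; rewrite invgK.
  by case: yX; [right|left].
elim: v {Wv} => [|y v IH]; first by rewrite /= !big_nil invg1.
by rewrite /= rev_cons -cats1 big_cat big_seq1 big_cons IH invgM.
Qed.

Lemma word_length_word (g : G) : generates X -> word_lengths X g (word_length X g).
Proof.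
move=> genX; have [n Hn] := exists_word g genX.
have ex : exists n, `[< word_lengths X g n >] by exists n; apply/asboolP.
rewrite /word_length; case: xgetP => [m _ []//|/(_ (ex_minn ex)) []].
by case: ex_minnP => m /asboolP Hm min; split=> // k /asboolP; exact: min.
Qed.

End Words.

(** * Hyperbolic left-invariant pseudometrics *)
Section HyperbolicPseudometric.
Set Implicit Arguments.
Unset Strict Implicit.
Unset Printing Implicit Defensive.
Local Open Scope ring_scope.
Context {R : realType} {G : groupType}.

(** The distance between orbit points, seen as a function of group elements; only
    a pseudometric, since elements may fix the base point. The last field is
    Gromov's inequality (x|z)_w >= min((x|y)_w, (y|z)_w) - delta with the
    minimum spelled out as a disjunction and the halves cleared, the form in
    which linear arithmetic can use it. *)
Record hyperbolic_pseudometric (d : G -> G -> R) (delta : R) : Prop := {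
  pdistxx : forall x, d x x = 0;
  pdistC : forall x y, d x y = d y x;
  pdist_tri : forall x y z, d x z <= d x y + d y z;
  pdistM : forall g x y, d (g * x)%g (g * y)%g = d x y;
  pdist_four : forall w x y z,
    d y w + d x z <= d x y + d z w + 2 * delta \/
    d y w + d x z <= d y z + d x w + 2 * delta }.

Context {d : G -> G -> R} {delta : R} (hd : hyperbolic_pseudometric d delta).

Definition gprod (w x y : G) : R := (d x w + d y w - d x y) / 2.

Lemma pdist_ge0 x y : 0 <= d x y.
Proof.
have := pdist_tri hd x y x; rewrite (pdistxx hd) (pdistC hd y x); lra.
Qed.

Lemma delta_ge0 : 0 <= delta.
Proof. by case: (pdist_four hd 1 1 1 1)%g; rewrite (pdistxx hd); lra. Qed.

Lemma pdist_len x y : d x y = d 1%g (x^-1 * y)%g.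
Proof. by rewrite -(pdistM hd x^-1%g) mulVg. Qed.

Lemma lenV g : d 1%g g^-1%g = d 1%g g.
Proof. by rewrite (pdistC hd) pdist_len invgK mulg1. Qed.

Lemma gprodM g w x y : gprod (g * w)%g (g * x)%g (g * y)%g = gprod w x y.
Proof. by rewrite /gprod !(pdistM hd). Qed.

Lemma gprodC w x y : gprod w x y = gprod w y x.
Proof. by rewrite /gprod (pdistC hd x y) (addrC (d x w)). Qed.

Lemma gprod_ge0 w x y : 0 <= gprod w x y.
Proof. have := pdist_tri hd x w y; rewrite /gprod (pdistC hd w y); lra. Qed.

Lemma gprod_swap w x y : gprod w x y = d w x - gprod x w y.
Proof. by rewrite /gprod (pdistC hd x w) (pdistC hd y w) (pdistC hd y x); lra. Qed.

Lemma gprod_lel w x y : gprod w x y <= d w x.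
Proof. by rewrite gprod_swap; have := gprod_ge0 x w y; lra. Qed.

Lemma gprod_ler w x y : gprod w x y <= d w y.
Proof. by rewrite gprodC gprod_lel. Qed.

Lemma gprod_hyp w x y z :
  gprod w x y - delta <= gprod w x z \/ gprod w y z - delta <= gprod w x z.
Proof.
case: (pdist_four hd w x y z) => H; [left|right]; rewrite /gprod; lra.
Qed.

Lemma gprod_lip w x y z : gprod w x z <= gprod w x y + d y z.
Proof.
have := pdist_tri hd x z y; have := pdist_tri hd z y w.
by rewrite /gprod (pdistC hd z y); lra.
Qed.

(** At a vertex of a broken path, the side [x, y] is so long that seen from x
    the point z lies in the direction of y; hence the turn at x towards z is
    the turn towards y up to delta, and likewise at y. *)
Lemma broken_geodesic A w x y z :
  gprod x w y <= A -> gprod y x z <= A -> 2 * A + 2 * delta < d x y ->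
  gprod x w z <= A + delta /\ gprod y w z <= A + delta.
Proof.
move=> H1 H2 H3; have d0 := delta_ge0; split.
- have := gprod_swap x y z.
  by case: (gprod_hyp x w z y) => H; rewrite ?(gprodC x z y) in H *; lra.
- have := gprod_swap y x w; rewrite (pdistC hd y x) (gprodC x y w).
  by case: (gprod_hyp y x w z) => H; lra.
Qed.

Lemma pdist_expg (f : G) m n : (m <= n)%N ->
  d (f ^+ m)%g (f ^+ n)%g = d 1%g (f ^+ (n - m))%g.
Proof. by move=> mn; rewrite -{1}(subnKC mn) expgnDr pdist_len mulKg. Qed.

Lemma len_expg_le (f : G) n : d 1%g (f ^+ n)%g <= n%:R * d 1%g f.
Proof.
elim: n => [|n IH]; first by rewrite expg0 (pdistxx hd) mul0r.
have := pdist_tri hd 1%g (f ^+ n)%g (f ^+ n.+1)%g.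
by rewrite (pdist_expg f (leqnSn n)) subSnn expg1 -natr1 mulrDl mul1r; lra.
Qed.

(** * Elements with a quasi-axis *)
(** The powers of f run along a quasi-geodesic through 1: they move away
    linearly, and the turn between backward and forward powers is bounded. The
    bound A does not depend on the exponents, which is what later allows
    arbitrarily long connectors with fixed constants. *)
Definition axial (A : R) (f : G) : Prop :=
  (forall n, n%:R <= d 1%g (f ^+ n)%g) /\
  (forall m n, gprod 1%g (f ^- m)%g (f ^+ n)%g <= A).

Lemma axial_ge0 A f : axial A f -> 0 <= A.
Proof. by case=> _ /(_ 0 0); apply: le_trans; exact: gprod_ge0. Qed.

Lemma axialV A f : axial A f -> axial A f^-1%g.
Proof.
case=> H1 H2; split=> [n|m n]; first by rewrite expVgn lenV.
by rewrite !expVgn invgK gprodC.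
Qed.

Lemma axialX A f p : (0 < p)%N -> axial A f -> axial A (f ^+ p)%g.
Proof.
move=> p0 [H1 H2]; split=> [n|m n].
  rewrite -expgnA; apply: le_trans (H1 _); rewrite ler_nat leq_pmull //.
by rewrite -!expgnA.
Qed.

Lemma axial_gprod A f i j n : axial A f -> (i <= j <= n)%N ->
  gprod (f ^+ j)%g (f ^+ i)%g (f ^+ n)%g <= A.
Proof.
move=> [_ H] /andP[ij jn]; rewrite -(gprodM (f ^- j)%g) mulVg.
have := H (j - i)%N (n - j)%N.
have com k : (f ^- j * f ^+ k = f ^+ k * f ^- j)%g.
  by symmetry; apply/commuteV/commuteX2.
by rewrite (expgnFr f ij) (expgnFr f jn) invgF !com.
Qed.

Lemma axial_line A f j n : axial A f -> (j <= n)%N ->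
  d 1%g (f ^+ j)%g - A <= gprod 1%g (f ^+ j)%g (f ^+ n)%g.
Proof.
move=> af jn; rewrite gprod_swap.
by have := @axial_gprod A f 0 j n af; rewrite jn expg0 => /(_ isT); lra.
Qed.

(** The hypothesis says that |f| exceeds twice the turn (f^-1|f) by at least
    4 delta + 1. By induction on n the path 1, f, ..., f^n then never turns back:
    each long side hides what lies before it, so the turn at f^n from 1 to
    f^(n+1) is still (f^-1|f) up to delta. *)
Lemma doubling_axial f : d 1%g f + 4 * delta + 1 <= d 1%g (f * f)%g ->
  axial (gprod 1%g f^-1%g f + 2 * delta) f.
Proof.
move=> Hf.
have d0 := delta_ge0.
set C := gprod _ _ _.
have CE : d 1%g f = 2 * C + (d 1%g (f * f)%g - d 1%g f).
  rewrite /C /gprod (pdist_len f^-1%g f) invgK (pdistC hd _ 1%g) (pdistC hd f) lenV.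
  lra.
have turn (h : G) : d 1%g h = d 1%g f -> gprod 1%g h^-1%g h = C ->
    forall n, gprod (h ^+ n)%g 1%g (h ^+ n.+1)%g <= C + delta.
  move=> hf hC; elim=> [|n IH].
    rewrite expg0 gprod_swap (pdistxx hd).
    have := gprod_ge0 1%g 1%g (h ^+ 1)%g; have := gprod_ge0 1%g f^-1%g f.
    rewrite -/C; lra.
  have E : gprod (h ^+ n.+1)%g (h ^+ n)%g (h ^+ n.+2)%g = C.
    rewrite -hC -(gprodM (h ^- n.+1)%g) mulVg (expgSr h n.+1) mulKg.
    by rewrite expgSr invgM mulgVK.
  have := gprod_swap (h ^+ n.+1)%g (h ^+ n)%g 1%g.
  rewrite (pdistC hd _ (h ^+ n)%g) (pdist_expg h (leqnSn n)) subSnn expg1 hf.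
  rewrite (gprodC (h ^+ n)%g) => S.
  by case: (gprod_hyp (h ^+ n.+1)%g (h ^+ n)%g 1%g (h ^+ n.+2)%g); rewrite E; lra.
have turnf := turn f erefl erefl.
have turnV : forall n, gprod (f^-1 ^+ n)%g 1%g (f^-1 ^+ n.+1)%g <= C + delta.
  by apply: turn; [exact: lenV | rewrite invgK gprodC].
split.
  elim=> [|n IH]; first by rewrite expg0 (pdistxx hd).
  have := turnf n; rewrite /gprod (pdistC hd (f ^+ n.+1)%g).
  rewrite (pdist_expg f (leqnSn n)) subSnn expg1 -(natr1 n); lra.
move=> [|m] [|n]; rewrite ?expg0 ?invg1.
- by have := gprod_lel 1%g 1%g 1%g; have := gprod_ge0 1%g f^-1%g f;
    rewrite -/C (pdistxx hd); lra.
- by have := gprod_lel 1%g 1%g (f ^+ n.+1)%g; have := gprod_ge0 1%g f^-1%g f;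
    rewrite -/C (pdistxx hd); lra.
- by have := gprod_ler 1%g (f ^- m.+1)%g 1%g; have := gprod_ge0 1%g f^-1%g f;
    rewrite -/C (pdistxx hd); lra.
have Hm : gprod 1%g (f ^- m.+1)%g f <= C + delta.
  by rewrite -(gprodM (f ^+ m.+1)%g) mulgV mulg1 -expgSr.
have Hn : gprod f 1%g (f ^+ n.+1)%g <= C + delta.
  have := turnV n; rewrite -(gprodM (f ^+ n.+1)%g) gprodC !expVgn mulg1.
  by rewrite mulgV expgS mulgK.
have := gprod_swap 1%g f (f ^+ n.+1)%g.
case: (gprod_hyp 1%g (f ^- m.+1)%g (f ^+ n.+1)%g f); rewrite ?(gprodC _ (f ^+ n.+1)%g f); lra.
Qed.

Lemma pdist_expgz f m n :
  d (expgz f m) (expgz f n) = d 1%g (f ^+ `|m - n|%N)%g.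
Proof.
have pos a b : d (f ^+ a)%g (f ^+ b)%g = d 1%g (f ^+ `|a%:Z - b%:Z|%N)%g.
  have [ab|ba] := leqP a b; first by rewrite (pdist_expg f ab) distnEr.
  by rewrite (pdistC hd) (pdist_expg f (ltnW ba)) distnEl// ltnW.
have com a b : (f ^+ a * f ^- b = f ^- b * f ^+ a)%g by apply/commuteV/commuteX2.
case: m n => [m|m] [n|n] /=; first exact: pos.
- rewrite -(pdistM hd (f ^+ n.+1)%g) mulgV -expgnDr (pdistC hd); congr (d _ (f ^+ _)%g); lia.
- rewrite -(pdistM hd (f ^+ m.+1)%g) mulgV -expgnDr; congr (d _ (f ^+ _)%g); lia.
rewrite -(pdistM hd (f ^+ m.+1 * f ^+ n.+1)%g) mulgK {1}(commuteX2 _ _ (erefl (f * f)%g)).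
by rewrite mulgK pos; congr (d _ (f ^+ _)%g); lia.
Qed.

(** * Translates of an axis *)
(** If x lies on the way to x', y on the way to y', and x', y' have a common
    initial direction reaching past x or y, then x and y are on one line from
    1 and their distance is the difference of their lengths. *)
Lemma fellow_travel E x x' y y' :
  d 1%g x - E <= gprod 1%g x x' -> d 1%g y - E <= gprod 1%g y y' ->
  d 1%g x <= gprod 1%g x' y' \/ d 1%g y <= gprod 1%g x' y' -> 0 <= E ->
  d x y <= `|d 1%g x - d 1%g y| + 2 * E + 4 * delta.
Proof.
move=> Hx Hy Hxy E0; have d0 := delta_ge0.
have := ler_norm (d 1%g x - d 1%g y).
have := ler_norm (d 1%g y - d 1%g x); rewrite distrC.
have : d x y = d 1%g x + d 1%g y - 2 * gprod 1%g x y.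
  by rewrite /gprod (pdistC hd x 1%g) (pdistC hd y 1%g); lra.
have := gprodC 1%g y y'.
by case: (gprod_hyp 1%g x x' y); case: (gprod_hyp 1%g x' y' y); case: Hxy; lra.
Qed.

(** Far enough along the translated axis, the direction of 1 is the direction of
    the starting point g. *)
Lemma axial_shift_turn A b g i n : axial A b ->
  d 1%g g + A + delta < i%:R -> (i <= n)%N ->
  gprod (g * b ^+ i)%g 1%g (g * b ^+ n)%g <= A + delta.
Proof.
move=> ab gi ij.
have : gprod (g * b ^+ i)%g g (g * b ^+ n)%g <= A.
  rewrite -{2}(mulg1 g) gprodM -(expg0 b); exact: axial_gprod.
have := gprod_swap (g * b ^+ i)%g g 1%g.
have := gprod_ler g (g * b ^+ i)%g 1%g.
have := pdistM hd g (b ^+ i)%g 1%g; rewrite mulg1 (pdistC hd _ 1%g).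
rewrite (pdistC hd g 1%g); have := ab.1 i.
by case: (gprod_hyp (g * b ^+ i)%g g 1%g (g * b ^+ n)%g); lra.
Qed.

Definition orbit_acylindrical : Prop :=
  forall eps : R, exists (r : R) (N : nat), forall x y, r <= d x y ->
    forall s : seq G, uniq s ->
      (forall g, g \in s -> d x (g * x)%g <= eps /\ d y (g * y)%g <= eps) ->
      (size s <= N)%N.

(** The translated axis g b^i and the axis a^j share a long initial direction, so
    a^(j-r) is near some g b^i. Multiplying by a^-r moves a^j back to a^(j-r),
    and g b^r g^-1 moves g b^i forward to g b^(i+r); both shifts have length
    |a^r| = |b^r|, so g b^(i+r) is again near a^j. The bound involves neither r
    nor g. *)
Lemma parallel_axes_displacement A M a b g i0 n r j :
  axial A a -> axial A b -> d 1%g a <= M -> d 1%g b <= M ->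
  d 1%g (a ^+ r)%g = d 1%g (b ^+ r)%g ->
  d 1%g g + A + delta < i0%:R -> (i0 <= n)%N -> (r <= j <= n)%N ->
  d 1%g (g * b ^+ i0)%g <= d 1%g (a ^+ (j - r))%g ->
  (j + r)%:R * M < gprod 1%g (a ^+ n)%g (g * b ^+ n)%g ->
  d (a ^+ j)%g (g * b ^+ r * g^-1 * a ^- r * a ^+ j)%g <=
    2 * M + 6 * A + 14 * delta.
Proof.
move=> aa ab aM bM abr gi0 i0n /andP[rj jn] Hlow Hhigh.
have d0 := delta_ge0; have A0 := axial_ge0 aa.
have M0 : 0 <= M by apply: le_trans aM; exact: pdist_ge0.
set F := fun i => d 1%g (g * b ^+ i)%g.
have Fstep i k : F (i + k)%N <= F i + k%:R * M.
  have := pdist_tri hd 1%g (g * b ^+ i)%g (g * b ^+ (i + k))%g.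
  rewrite (pdistM hd) pdist_expg ?leq_addr// addKn => H.
  have := len_expg_le b k; have := ler_wpM2l (ler0n R k) bM; rewrite /F; lra.
have lena k : d 1%g (a ^+ k)%g <= k%:R * M.
  by have := len_expg_le a k; have := ler_wpM2l (ler0n R k) aM; lra.
have jrj : (j - r <= j)%N by rewrite leq_subr.
have Hv : d 1%g (a ^+ (j - r))%g + r%:R * M < F n.
  have := gprod_ler 1%g (a ^+ n)%g (g * b ^+ n)%g; rewrite -/(F n).
  have := lena (j - r)%N.
  have : (j - r)%:R * M <= j%:R * M by apply: ler_wpM2r => //; rewrite ler_nat.
  move: Hhigh; rewrite natrD mulrDl; lra.
have rM0 : 0 <= r%:R * M by apply: mulr_ge0.
(* g b^i is the point of the translated axis at the same distance from 1 as
   a^(j-r), up to one step. *)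
have [|i /andP[i0i iN] /andP[Fi1 Fi2]] :=
  discrete_ivt i0n Hlow (v := d 1%g (a ^+ (j - r))%g) (F := F).
  by rewrite /F -/(F n); lra.
have irn : (i + r <= n)%N.
  rewrite leqNgt; apply/negP => nir.
  have := Fstep i (n - i)%N; rewrite subnKC ?(ltnW iN)// => FnI.
  have : (n - i)%:R * M <= r%:R * M.
    by apply: ler_wpM2r => //; rewrite ler_nat leq_subLR ltnW.
  lra.
have gi k : (i0 <= k)%N -> d 1%g g + A + delta < k%:R.
  by move=> ik; apply: lt_le_trans gi0 _; rewrite ler_nat.
have lineb k : (i0 <= k <= n)%N ->
    d 1%g (g * b ^+ k)%g - (A + delta) <= gprod 1%g (g * b ^+ k)%g (g * b ^+ n)%g.
  move=> /andP[ik kn]; rewrite gprod_swap.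
  have := axial_shift_turn ab (gi k ik) kn; lra.
have linea k : (k <= n)%N ->
    d 1%g (a ^+ k)%g - (A + delta) <= gprod 1%g (a ^+ k)%g (a ^+ n)%g.
  by move=> kn; have := axial_line aa kn; lra.
have E0 : 0 <= A + delta by lra.
have irange : (i0 <= i <= n)%N by rewrite i0i ltnW.
have high k : (k <= j)%N -> d 1%g (a ^+ k)%g <= gprod 1%g (a ^+ n)%g (g * b ^+ n)%g.
  move=> kj; have := lena k; have : k%:R * M <= j%:R * M.
    by apply: ler_wpM2r => //; rewrite ler_nat.
  by move: Hhigh; rewrite natrD mulrDl; lra.
have near1 : d (a ^+ (j - r))%g (g * b ^+ i)%g <= M + 2 * A + 6 * delta.
  have := fellow_travel (linea _ (leq_trans jrj jn)) (lineb _ irange)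
    (or_introl (high _ jrj)) E0.
  have := Fstep i 1%N; rewrite addn1 mul1r; move: Fi1 Fi2; rewrite /F => Fi1 Fi2.
  by rewrite ger0_norm; lra.
have near2 : d (a ^+ j)%g (g * b ^+ (i + r))%g <= M + 4 * A + 8 * delta.
  have := fellow_travel (linea _ jn) (lineb (i + r)%N _) (or_introl (high _ (leqnn j))) E0.
  rewrite irn (leq_trans i0i (leq_addr r i)) => /(_ isT).
  have : `|d 1%g (a ^+ j)%g - d 1%g (g * b ^+ (i + r))%g| <= M + 2 * A + 2 * delta.
    have := axial_gprod aa (i := 0) (j := j - r) (n := j); rewrite jrj expg0 => /(_ isT).
    have := gprod_ge0 (a ^+ (j - r))%g 1%g (a ^+ j)%g.
    have := axial_shift_turn ab (gi i i0i) (leq_addr r i).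
    have := gprod_ge0 (g * b ^+ i)%g 1%g (g * b ^+ (i + r))%g.
    rewrite /gprod (pdistM hd g) (pdistC hd (b ^+ (i + r))%g) pdist_expg ?leq_addr//.
    rewrite (pdistC hd (a ^+ j)%g) (pdist_expg a jrj) subKn// addKn abr.
    have := Fstep i 1%N; rewrite addn1 mul1r; move: Fi1 Fi2; rewrite /F => Fi1 Fi2.
    by rewrite ler_norml; lra.
  by lra.
have -> : (g * b ^+ r * g^-1 * a ^- r * a ^+ j = g * b ^+ r * g^-1 * a ^+ (j - r))%g.
  by rewrite -{1}(subnKC rj) expgnDr !mulgA mulgVK.
have := pdist_tri hd (a ^+ j)%g (g * b ^+ (i + r))%g (g * b ^+ r * g^-1 * a ^+ (j - r))%g.
have E : (g * b ^+ (i + r) = g * b ^+ r * g^-1 * (g * b ^+ i))%g.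
  by rewrite !mulgA mulgVK -mulgA -expgnDr addnC.
by rewrite {2}E (pdistM hd) (pdistC hd (g * b ^+ i)%g); lra.
Qed.

(** All the elements g b^s g^-1 a^-s with s <= N displace two far apart points
    a^j1 and a^j2 by the bound of [parallel_axes_displacement], so acylindricity
    makes two of them coincide. The bound N depends only on A and M because that
    displacement bound does, and this uniformity in g is what yields a single
    power of f valid for the whole group. *)
Lemma axial_commensurate A M : orbit_acylindrical -> exists N,
  forall a b g, axial A a -> axial A b -> d 1%g a <= M -> d 1%g b <= M ->
    (forall r, d 1%g (a ^+ r)%g = d 1%g (b ^+ r)%g) ->
    (forall C, exists n, C < gprod 1%g (a ^+ n)%g (g * b ^+ n)%g) ->
  exists2 p, (0 < p <= N)%N & (g * b ^+ p = a ^+ p * g)%g.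
Proof.
move=> acyl; have [r [N acylN]] := acyl (2 * M + 6 * A + 14 * delta).
exists N => a b g aa ab aM bM abr unb.
have M0 : 0 <= M by apply: le_trans aM; exact: pdist_ge0.
(* i0: where the translated axis has become straight as seen from 1; J0: an
   exponent from which the axis a^j lies farther than g b^i0. *)
have [i0 gi0] := nat_gt (d 1%g g + A + delta).
have [J0 HJ0] := nat_gt (d 1%g (g * b ^+ i0)%g).
have [k rk] := nat_gt r.
pose j1 := (J0 + N)%N; pose j2 := (j1 + k)%N.
have [n Hn] := unb ((i0 + j2 + N)%:R * M).
have nbig : (i0 + j2 + N <= n)%N.
  rewrite leqNgt; apply/negP => nlt.
  have := gprod_lel 1%g (a ^+ n)%g (g * b ^+ n)%g; have := len_expg_le a n.
  have := ler_wpM2l (ler0n R n) aM.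
  have : n%:R * M <= (i0 + j2 + N)%:R * M by apply: ler_wpM2r => //; rewrite ler_nat ltnW.
  lra.
have displ s j : (s <= N)%N -> (j1 <= j <= j2)%N ->
    d (a ^+ j)%g (g * b ^+ s * g^-1 * a ^- s * a ^+ j)%g <= 2 * M + 6 * A + 14 * delta.
  move=> sN /andP[j1j jj2].
  have jj : (J0 + s <= j)%N by apply: leq_trans j1j; rewrite leq_add2l.
  apply: (@parallel_axes_displacement A M a b g i0 n) => //.
  - by apply: leq_trans nbig; rewrite -addnA leq_addr.
  - rewrite (leq_trans (leq_addl J0 s) jj) (leq_trans jj2) //.
    by apply: leq_trans nbig; rewrite addnAC leq_addl.
  - apply: le_trans (ltW HJ0) (le_trans _ (aa.1 _)).
    by rewrite ler_nat leq_subRL ?(leq_trans (leq_addl J0 s)) // addnC.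
  - apply: le_lt_trans Hn; apply: ler_wpM2r => //; rewrite ler_nat.
    by rewrite -addnA (leq_trans (leq_add jj2 sN)) // leq_addl.
pose w s := (g * b ^+ s * g^-1 * a ^- s)%g.
have : ~~ uniq [seq w s | s <- iota 0 N.+1].
  apply/negP => us; have := acylN (a ^+ j1)%g (a ^+ j2)%g _ _ us.
  rewrite size_map size_iota ltnn => H; suff : false by [].
  apply: H => [|x /mapP[s]].
    rewrite pdist_expg ?leq_addr// addKn; have := aa.1 k; lra.
  rewrite mem_iota add0n ltnS => /= sN ->.
  by split; apply: displ; rewrite // leqnn ?leq_addr.
move=> /(uniqPn 1%g)[s [t [st]]]; rewrite size_map size_iota => tN.
rewrite !(nth_map 0) ?size_iota ?(ltn_trans st)// !nth_iota ?(ltn_trans st)// !add0n.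
rewrite /w => E; exists (t - s)%N;
  first by rewrite subn_gt0 st (leq_trans (leq_subr s t) (ltnSE tN)).
have E2 : (g * b ^+ t * g^-1 = g * b ^+ s * g^-1 * a ^+ (t - s))%g.
  have ts : (a ^- s * a ^+ t = a ^+ (t - s))%g.
    by rewrite -{1}(subnKC (ltnW st)) expgnDr mulKg.
  by rewrite -ts !mulgA E -!mulgA mulVg mulg1.
have : (g^-1 * (g * b ^+ t * g^-1) * g = g^-1 * (g * b ^+ s * g^-1 * a ^+ (t - s)) * g)%g.
  by rewrite E2.
rewrite !mulgA mulVg !mul1g mulgVK -{1}(subnKC (ltnW st)) expgnDr -!mulgA.
by move=> /mulgI ->; rewrite mulVKg.
Qed.

(** * Elements normalizing an axis *)
(** Were the product larger, u would be closer to f^k than to 1 by more than 1,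
    and f^-k u would be shorter than the third hypothesis
    allows. *)
Lemma nearest_to_axis A f u k n : axial A f -> 2 * A + 2 * delta + 1 < k%:R ->
  (forall j, d 1%g u <= d (f ^+ j)%g u + 1) -> (k <= n)%N ->
  gprod 1%g u (f ^+ n)%g <= d 1%g (f ^+ k)%g.
Proof.
move=> af Hk Hu kn; rewrite leNgt; apply/negP => H.
have := axial_ge0 af; have := af.1 k; have := Hu k; have := axial_line af kn.
have := gprodC 1%g (f ^+ n)%g (f ^+ k)%g.
have : d (f ^+ k)%g u = d 1%g u + d 1%g (f ^+ k)%g - 2 * gprod 1%g u (f ^+ k)%g.
  by rewrite /gprod (pdistC hd u) (pdistC hd (f ^+ k)%g 1%g) (pdistC hd (f ^+ k)%g u); lra.
by case: (gprod_hyp 1%g u (f ^+ n)%g (f ^+ k)%g); lra.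
Qed.

(** Choose u of nearly minimal length in the coset of g. Then u projects to 1 on
    the axis in both directions, so both diagonals of the parallelogram 1, f^n,
    u f^n, u, whose sides are |u| and |f^n| by commutation, are about as long as
    two sides together. Hyperbolicity forbids this for large n unless u is
    short. *)
Lemma centralizer_near_axis A f : axial A f -> exists K, forall g,
  (g * f = f * g)%g -> exists u z, [/\ (u * f = f * u)%g, d 1%g u <= K,
    range (expgz f) z & (g = u * z)%g].
Proof.
move=> af; have [k Hk] := nat_gt (2 * A + 2 * delta + 1).
pose B := d 1%g (f ^+ k)%g.
exists (2 * B + delta) => g gf.
have [[m n] Hmin] := @approx_minimizer R (nat * nat)
  (fun p => d 1%g (f ^+ p.1 * f ^- p.2 * g)%g) (0, 0)%N (fun _ => pdist_ge0 _ _).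
pose z := (f ^+ m * f ^- n)%g; pose u := (z * g)%g.
have zf : commute z f.
  by apply/commute_sym; apply: commuteM; [|apply: commuteV]; exact: commuteX.
have uf : commute u f by apply/commute_sym/commuteM; apply/commute_sym.
have gz : commute g z by apply: commuteM; [|apply: commuteV]; exact: commuteX.
exists u, z^-1%g; split => //; last first.
- by rewrite /u -gz mulgK.
- by apply/range_expgzV/range_expgzP; exists m, n.
have d0 := delta_ge0.
have HuV j : d 1%g u <= d (f^-1 ^+ j)%g u + 1.
  have := Hmin (m + j, n)%N.
  rewrite (pdist_len (f^-1 ^+ j)%g u) expVgn invgK /= addnC expgnDr /u /z !mulgA.
  lra.
have Hu j : d 1%g u <= d (f ^+ j)%g u + 1.
  have := Hmin (m, n + j)%N.
  rewrite (pdist_len (f ^+ j)%g u) /= expgnDr invgM /u /z.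
  have E : (f ^- j * f ^+ m = f ^+ m * f ^- j)%g by symmetry; apply/commuteV/commuteX2.
  by rewrite !mulgA E -/z; lra.
have [N HN] := nat_gt (2 * B + delta).
have far := af.1 (k + N)%N.
have N0 : N%:R <= (k + N)%:R :> R by rewrite ler_nat leq_addl.
have G1 := nearest_to_axis af Hk Hu (leq_addr N k).
have G2 := nearest_to_axis (axialV af) Hk HuV (leq_addr N k).
have un : (f ^+ (k + N) * u = u * f ^+ (k + N))%g.
  by symmetry; exact: commuteX.
move: G1 G2; rewrite -/B !expVgn lenV -/B.
have -> : gprod 1%g u (f ^- (k + N))%g =
  (d 1%g u + d 1%g (f ^+ (k + N))%g - d 1%g (u * f ^+ (k + N))%g) / 2.
  rewrite /gprod (pdistC hd u) (pdistC hd _ 1%g) lenV (pdistC hd _ (f ^- (k + N))%g).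
  by rewrite (pdist_len (f ^- (k + N))%g) invgK un.
rewrite /gprod (pdistC hd u) (pdistC hd _ 1%g).
have := pdist_four hd 1%g (f ^+ (k + N))%g (u * f ^+ (k + N))%g u.
have -> : d (f ^+ (k + N))%g (u * f ^+ (k + N))%g = d 1%g u.
  by rewrite -un -{1}(mulg1 (f ^+ (k + N))%g) (pdistM hd).
have -> : d (u * f ^+ (k + N))%g u = d 1%g (f ^+ (k + N))%g.
  by rewrite -{2}(mulg1 u) (pdistM hd) (pdistC hd).
rewrite !(pdistC hd _ 1%g) (pdistC hd u (f ^+ (k + N))%g).
by move=> [|]; lra.
Qed.

(** The short representatives of the centralizer of e displace 1 and every e^k
    by the same bounded amount, so acylindricity leaves finitely many of them.
    The elements inverting e form at most one further coset of the
    centralizer. *)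
Lemma normalized_axis_virtually_cyclic A e : orbit_acylindrical -> axial A e ->
  (forall g, (g * e = e * g)%g \/ (g * e = e^-1 * g)%g) -> virtually_cyclic G.
Proof.
move=> acyl ae He; exists e.
have [K HK] := centralizer_near_axis ae.
have [r [N acylN]] := acyl K; have [k rk] := nat_gt r.
pose U := [set u | (u * e = e * u)%g /\ d 1%g u <= K].
have finU : finite_set U.
  apply: (@card_le_finite _ _ _ `I_N) => //; apply: uniq_card_le => s us sU.
  apply: (acylN 1%g (e ^+ k)%g) => // [|g /sU[ge gK]]; first by have := ae.1 k; lra.
  rewrite mulg1 (commuteX k ge); split=> //.
  by rewrite -{1}(mulg1 (e ^+ k)%g) (pdistM hd).
pose coset g := [set (g * h)%g | h in range (expgz e)].
have cent g : (g * e = e * g)%g -> exists2 u, U u & exists2 z, range (expgz e) z & (g = u * z)%g.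
  by move=> /HK[u [z [ue uK ez ->]]]; exists u => //; exists z.
have [[v ve]|nov] := pselect (exists v, (v * e = e^-1 * v)%g); last first.
  apply: (@sub_finite_set _ _ (coset @` U)); last exact: finite_image.
  move=> _ [g _ <-]; have [/cent[u Uu [z ez ->]]|gV] := He g; last by case: nov; exists g.
  by exists u => //; rewrite /coset cyclic_cosetM.
apply: (@sub_finite_set _ _ (coset @` U `|` coset @` ((fun u => v * u)%g @` U))).
  move=> _ [g _ <-]; have [/cent[u Uu [z ez ->]]|gV] := He g.
    by left; exists u => //; rewrite /coset cyclic_cosetM.
  right; have /cent[u Uu [z ez E]] : (v^-1 * g * e = e * (v^-1 * g))%g.
    have vV : (v^-1 * e^-1 = e * v^-1)%g.
      by apply: (mulgI v); rewrite mulVKg mulgA ve mulgK.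
    by rewrite -mulgA gV !mulgA vV.
  exists (v * u)%g; first by exists u.
  have -> : g = (v * u * z)%g by rewrite -mulgA -E mulVKg.
  by rewrite /coset (cyclic_cosetM (v * u)%g ez).
by rewrite finite_setU; split; [exact: finite_image | apply: finite_image; exact: finite_image].
Qed.

(** * Connectors *)
Definition signed (s : bool) (f : G) : G := if s then f else f^-1%g.

(** Otherwise every g sends some ray of the axis of f along a ray of that axis;
    with N from [axial_commensurate], f^(N!) is then normalized by every g and
    G would be virtually cyclic. *)
Lemma independent_translate A f : orbit_acylindrical -> axial A f ->
  ~ virtually_cyclic G ->
  exists g C, forall s t n,
    gprod 1%g (signed s f ^+ n)%g (g * signed t f ^+ n)%g <= C.
Proof.
move=> acyl af nvc; apply: contrapT => Hno; apply: nvc.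
have asg s : axial A (signed s f) by case: s => //; exact: axialV.
have lens s n : d 1%g (signed s f ^+ n)%g = d 1%g (f ^+ n)%g.
  by case: s; rewrite //= expVgn lenV.
have [N HN] := axial_commensurate A (d 1%g f) acyl.
pose e := (f ^+ N`!)%g.
have ae : axial A e by apply: axialX => //; exact: fact_gt0.
have sE s : (signed s f ^+ N`! = signed s e)%g by case: s; rewrite //= expVgn.
apply: (normalized_axis_virtually_cyclic acyl ae) => g.
have [s [t Hst]] : exists s t, forall C, exists n,
    C < gprod 1%g (signed s f ^+ n)%g (g * signed t f ^+ n)%g.
  apply: contrapT => H; apply: Hno; exists g.
  have B s t : exists C, forall n, gprod 1%g (signed s f ^+ n)%g (g * signed t f ^+ n)%g <= C.
    apply: contrapT => H2; apply: H; exists s, t => C; apply: contrapT => H3.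
    apply: H2; exists C => n; rewrite leNgt; apply/negP => H4; apply: H3; by exists n.
  have [C1 H1] := B true true; have [C2 H2] := B true false.
  have [C3 H3] := B false true; have [C4 H4] := B false false.
  have := ler_norm C1; have := ler_norm C2; have := ler_norm C3; have := ler_norm C4.
  have := normr_ge0 C1; have := normr_ge0 C2; have := normr_ge0 C3; have := normr_ge0 C4.
  move=> ? ? ? ? ? ? ? ?; exists (`|C1| + `|C2| + `|C3| + `|C4|).
  by move=> [] [] n; [have := H1 n|have := H2 n|have := H3 n|have := H4 n]; lra.
have [p /andP[p0 pN] gp] : exists2 p, (0 < p <= N)%N &
    (g * signed t f ^+ p = signed s f ^+ p * g)%g.
  have len1 s' : d 1%g (signed s' f) <= d 1%g f by have := lens s' 1; rewrite !expg1 => ->.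
  by apply: HN => // r; rewrite !lens.
have /dvdnP[q Nq] : (p %| N`!)%N by rewrite dvdn_fact ?p0.
have := expg_intertwine q gp; rewrite -!expgnA mulnC -Nq !sE.
move: s t {Hst gp} => [] [] /= E; [left|right|right|left] => //.
- by apply: (mulgI e); rewrite mulVKg mulgA -E mulgVK.
- by apply: (mulIg e^-1%g); rewrite mulgK -mulgA E mulVKg.
Qed.

(** A direction y close to two of the points x_i would make these close to each
    other. *)
Lemma separated_avoid C (x : 'I_3 -> G) y :
  (forall i j, i != j -> gprod 1%g (x i) (x j) <= C) ->
  exists i, forall j, j != i -> gprod 1%g y (x j) <= C + delta.
Proof.
move=> sep; have [[i Hi]|no] := pselect (exists i, C + delta < gprod 1%g y (x i)).
  exists i => j ji; rewrite leNgt; apply/negP => Hj.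
  have := sep _ _ ji; have := gprodC 1%g (x j) y.
  by case: (gprod_hyp 1%g (x j) y (x i)); lra.
by exists ord0 => j _; rewrite leNgt; apply/negP => Hj; apply: no; exists j.
Qed.

(** The constant C is chosen before the length L, and each pair y, z excludes at
    most one connector for its forward and one for its backward end, whence the
    need for three. *)
Lemma three_connectors : orbit_acylindrical -> ~ virtually_cyclic G ->
  (exists A f, axial A f) ->
  exists C, forall L, exists x : 'I_3 -> G, (forall i, L <= d 1%g (x i)) /\
    forall y z, exists i, gprod 1%g y (x i) <= C /\ gprod 1%g (x i)^-1%g z <= C.
Proof.
move=> acyl nvc [A [f af]].
have [g [C0 HC0]] := independent_translate acyl af nvc.
have A0 := axial_ge0 af; have d0 := delta_ge0.
have C00 : 0 <= C0 by apply: le_trans (HC0 true true 0); exact: gprod_ge0.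
have g0 := pdist_ge0 1%g g.
exists (A + C0 + d 1%g g + delta) => L.
have [n Hn] := nat_gt (L + 2 * d 1%g g).
pose c := (g * f ^+ n * g^-1)%g.
pose x (i : 'I_3) := nth 1%g [:: f ^+ n; f ^- n; c]%g i.
have cV : (c^-1 = g * f ^- n * g^-1)%g by rewrite /c !invgM invgK mulgA.
have step t : d (g * signed t f ^+ n)%g (g * signed t f ^+ n * g^-1)%g = d 1%g g.
  by rewrite -{1}(mulg1 (g * signed t f ^+ n)%g) (pdistM hd) lenV.
have lenc : L <= d 1%g c.
  have := step true; have := pdist_tri hd 1%g c (g * f ^+ n)%g; rewrite /= -/c.
  have := pdist_tri hd g 1%g (g * f ^+ n)%g; have := af.1 n.
  have -> : d g (g * f ^+ n)%g = d 1%g (f ^+ n)%g by rewrite -{1}(mulg1 g) (pdistM hd).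
  rewrite (pdistC hd g 1%g) (pdistC hd c); lra.
have sep2 s t : gprod 1%g (signed s f ^+ n)%g (g * signed t f ^+ n * g^-1)%g <= A + C0 + d 1%g g.
  have := gprod_lip 1%g (signed s f ^+ n)%g (g * signed t f ^+ n)%g (g * signed t f ^+ n * g^-1)%g.
  by rewrite step; have := HC0 s t n; lra.
have sep1 : gprod 1%g (f ^- n)%g (f ^+ n)%g <= A + C0 + d 1%g g.
  by have := af.2 n n; lra.
exists x; split.
  by have fn := af.1 n; case=> -[|[|[|i]]] //= Hi; rewrite /x /= ?lenV; lra.
have sep i j : i != j -> gprod 1%g (x i) (x j) <= A + C0 + d 1%g g.
  have := sep2 true true; have := sep2 false true; rewrite /= expVgn -/c => H1 H2.
  case: i => -[|[|[|i]]] Hi; case: j => -[|[|[|j]]] Hj //= _; rewrite /x //= gprodC //.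
have sepV i j : i != j -> gprod 1%g (x i)^-1%g (x j)^-1%g <= A + C0 + d 1%g g.
  have := sep2 true false; have := sep2 false false; rewrite /= expVgn -cV => H1 H2.
  case: i => -[|[|[|i]]] Hi; case: j => -[|[|[|j]]] Hj //= _;
    rewrite /x //= ?invgK // gprodC //.
move=> y z; have [i Hi] := separated_avoid y sep; have [j Hj] := separated_avoid z sepV.
have [k [ki kj]] := avoid_two i j; exists k; split; first exact: Hi.
by rewrite gprodC; exact: Hj.
Qed.

(** * Groups without doubling elements *)
(** In a tree, elements that are not loxodromic fix the midpoints of [1, g] and
    [1, h], and if their fixed sets were disjoint then g h would be loxodromic;
    so the two geodesics agree up to the first midpoint. Coarsely: if g and h
    parted before, then so would g^-1 and h^-1 from them, the path 1, g, gh,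
    ghg, ghgh would turn little at each vertex, and (gh)^2 would be too
    long. *)
Lemma no_doubling_gprod : (forall f, d 1%g (f * f)%g < d 1%g f + 4 * delta + 1) ->
  forall g h, d 1%g g <= d 1%g h ->
    d 1%g g / 2 - (3 * delta + 1) <= gprod 1%g g h.
Proof.
move=> nodb g h gh; rewrite leNgt; apply/negP.
set A := gprod _ _ _ => HA; have d0 := delta_ge0.
have back f : d 1%g f / 2 - (2 * delta + 1 / 2) <= gprod 1%g f f^-1%g.
  rewrite gprodC /gprod !(pdistC hd _ 1%g) lenV (pdist_len f^-1%g f) invgK.
  by have := nodb f; lra.
have gVh : gprod 1%g g^-1%g h <= A + delta.
  by have := back g; case: (gprod_hyp 1%g g g^-1%g h); rewrite -/A; lra.
have hVg : gprod 1%g h^-1%g g <= A + delta.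
  have := back h; rewrite !(gprodC _ h^-1%g).
  by case: (gprod_hyp 1%g g h^-1%g h); rewrite -/A ?(gprodC _ h^-1%g h); lra.
have turn1 : gprod (g * h)%g 1%g (g * h * g)%g <= A + 2 * delta.
  have [||| _] := @broken_geodesic (A + delta) 1%g g (g * h)%g (g * h * g)%g.
  - by rewrite -(gprodM g^-1%g) mulVg mulg1 mulKg.
  - by rewrite -(gprodM (g * h)^-1%g) mulVg mulKg invgM mulgVK.
  - by rewrite -{1}(mulg1 g) (pdistM hd); lra.
  - lra.
have turn2 : gprod (g * h)%g 1%g (g * h * (g * h))%g <= A + 3 * delta.
  have [||| H _] :=
    @broken_geodesic (A + 2 * delta) 1%g (g * h)%g (g * h * g)%g (g * h * (g * h))%g.
  - exact: turn1.
  - rewrite mulgA -(gprodM (g * h * g)^-1%g) mulVg mulKg (invgM (g * h)%g) mulgVK; lra.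
  - by rewrite -{1}(mulg1 (g * h)%g) (pdistM hd); lra.
  - lra.
have := nodb (g * h)%g; move: turn2 gVh.
have -> : gprod (g * h)%g 1%g (g * h * (g * h))%g =
    d 1%g (g * h)%g - d 1%g (g * h * (g * h))%g / 2.
  have sq u : d (u * u)%g u = d 1%g u by rewrite -{3}(mulg1 u) (pdistM hd) (pdistC hd).
  rewrite /gprod sq; lra.
rewrite /gprod !(pdistC hd _ 1%g) lenV (pdist_len g^-1%g h) invgK; lra.
Qed.
(** * Counting products through a connector *)
Lemma len_word_ball (X : set G) : finite_set X -> generates X ->
  exists K : nat, forall n g, word_ball X [set: G] n g -> d 1%g g <= (K * n)%:R.
Proof.
move=> /finite_seqP[s Xs] genX.
have [K HK] : exists K : nat, forall x, x \in s -> d 1%g x <= K%:R.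
  elim: s {Xs} => [|y s [K HK]]; first by exists 0.
  have [m Hm] := nat_gt (d 1%g y).
  exists (K + m)%N => x; rewrite inE natrD => /predU1P[->|/HK].
    by have := ler0n R K; lra.
  by have := ler0n R m; lra.
exists K => n g [_ gn].
have [w [Ww wn <-]] := word_length_word g genX.
apply: le_trans (_ : (K * size w)%:R <= _); last by rewrite ler_nat leq_mul2l wn gn orbT.
elim: w Ww {wn} => [|y w IH] Ww; first by rewrite big_nil (pdistxx hd).
rewrite big_cons /= mulnS natrD.
have := pdist_tri hd 1%g y (y * \prod_(x <- w) x)%g.
have -> : d y (y * \prod_(x <- w) x)%g = d 1%g (\prod_(x <- w) x)%g.
  by rewrite -{1}(mulg1 y) (pdistM hd).
have := IH (fun x xw => Ww x (mem_behead (s := y :: w) xw)).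
have : d 1%g y <= K%:R.
  have : X y \/ X y^-1%g by apply: Ww; rewrite mem_head.
  by rewrite Xs => -[/HK//|/HK]; rewrite lenV.
lra.
Qed.

(** Two points on the way from w to z are compared by their distances to z. *)
Lemma close_between A w z a b :
  gprod a w z <= A -> gprod b w z <= A ->
  d a b <= `|d z a - d z b| + 2 * A + 2 * delta.
Proof.
move=> G1 G2.
have := ler_norm (d z a - d z b); have := ler_norm (d z b - d z a).
rewrite distrC; move: G1 G2; rewrite /gprod.
have := pdist_four hd w a z b.
rewrite !(pdistC hd z) !(pdistC hd w) => four G1 G2.
by case: four; lra.
Qed.

(** The quantities |xk| and |xk'| are the distances from h and h' to the common
    product, that is, the positions of h and h' on a geodesic ending there. *)
Lemma same_position_close C L h h' x k k' :
  gprod 1%g h^-1%g x <= C -> gprod 1%g x^-1%g k <= C ->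
  gprod 1%g h'^-1%g x <= C -> gprod 1%g x^-1%g k' <= C ->
  2 * C + 2 * delta < L -> L <= d 1%g x ->
  (h * x * k = h' * x * k')%g ->
  `|d 1%g (x * k)%g - d 1%g (x * k')%g| <= 1 ->
  d h h' <= 4 * C + 4 * delta + 1 /\
  d (h * x)%g (h' * x)%g <= 4 * C + 4 * delta + 1.
Proof.
move=> H1 H2 H1' H2' HL Lx E pos.
have C0 : 0 <= C by apply: le_trans H1; exact: gprod_ge0.
have d0 := delta_ge0.
have turns (a b : G) : gprod 1%g a^-1%g x <= C -> gprod 1%g x^-1%g b <= C ->
    gprod a 1%g (a * x * b)%g <= C + delta /\
    gprod (a * x)%g 1%g (a * x * b)%g <= C + delta.
  move=> A1 A2; apply: broken_geodesic.
  - by rewrite -(gprodM a^-1%g) mulVg mulg1 mulKg.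
  - by rewrite -(gprodM (a * x)^-1%g) mulVg mulKg invgM mulgVK.
  - by rewrite -{1}(mulg1 a) (pdistM hd); lra.
have [T1 T2] := turns _ _ H1 H2; have [T1' T2'] := turns _ _ H1' H2'.
have tail (a b : G) : d (a * b)%g a = d 1%g b.
  by rewrite -{2}(mulg1 a) (pdistM hd) (pdistC hd).
rewrite -E in T1' T2'; split.
  have := close_between T1 T1'.
  by rewrite {2}E -!mulgA !tail; lra.
have := close_between T2 T2'; rewrite {2}E !tail.
(* d(hx, g) = |k| is determined by d(h, g) = |xk| up to the turn at hx. *)
have lk (b : G) :
    d 1%g b = d 1%g (x * b)%g - d 1%g x + 2 * gprod 1%g x^-1%g b.
  rewrite /gprod (pdistC hd _ 1%g) lenV (pdistC hd b).
  by rewrite (pdist_len x^-1%g) invgK; lra.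
have : `|d 1%g k - d 1%g k'| <= 2 * C + 1.
  move: pos; rewrite (lk k) (lk k') !ler_norml.
  by have := gprod_ge0 1%g x^-1%g k; have := gprod_ge0 1%g x^-1%g k'; lra.
lra.
Qed.

(** Colour a pair (h, k) of a fibre by its connector and the integer part of the
    position |x_i k|, which is at most |x_i| + O(n). Within a colour, the
    elements h' h0^-1 displace h0 and h0 x_i boundedly and there are at most N
    of them by acylindricity at radius r <= |x_i|. *)
Lemma connectors_linear_ambiguity (X : set G) (I : finType) C :
  finite_set X -> generates X -> orbit_acylindrical ->
  (forall L, exists x : I -> G, (forall i, L <= d 1%g (x i)) /\
    forall y z, exists i, gprod 1%g y (x i) <= C /\
      gprod 1%g (x i)^-1%g z <= C) ->
  exists f : nat -> nat, ambiguity_function X f /\ linearly_bounded R f.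
Proof.
move=> finX genX acyl conn.
have [r [N acylN]] := acyl (4 * C + 4 * delta + 1).
have [x [xL xP]] := conn (Num.max r (2 * C + 2 * delta + 1)).
have {xL} [xr xL] : (forall i, r <= d 1%g (x i)) /\
    (forall i, 2 * C + 2 * delta + 1 <= d 1%g (x i)).
  by split=> i; apply: le_trans (xL i); rewrite le_max lexx ?orbT.
have [K HK] := len_word_ball finX genX.
pose bound := (\max_i Num.truncn (d 1%g (x i)))%N.+1.
have xbound i : d 1%g (x i) <= bound%:R.
  apply: le_trans (ltW (truncnS_gt _)) _; rewrite ler_nat ltnS.
  exact: leq_bigmax.
have [sel selP] := choice (fun p : G * G => xP p.1^-1%g p.2).
pose Phi h k := (h * x (sel (h, k)) * k)%g.
pose m n := (bound + K * n).+1.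
exists (fun n => (#|I| * m n) * N)%N; split; last first.
  exists (#|I| * K * N)%:R, (#|I| * bound.+1 * N)%:R; split; rewrite ?ler0n// => n.
  by rewrite -natrM -natrD ler_nat; apply: eq_leq; rewrite /m; lia.
exists Phi.
  exists (\max_i word_length X (x i))%N => h k _ _; exists (x (sel (h, k))) => //.
  by split=> //; exact: (leq_bigmax (F := fun i => word_length X (x i))).
move=> m0 n g _; apply: uniq_card_le => s us sF.
have posn p : p \in s -> d 1%g (x (sel p) * p.2)%g < (m n)%:R.
  case/sF => _ pn _; have := HK _ _ pn; have := xbound (sel p).
  have := pdist_tri hd 1%g (x (sel p)) (x (sel p) * p.2)%g.
  rewrite -{3}(mulg1 (x (sel p))) (pdistM hd) /m -natr1 natrD; lra.
pose color (p : G * G) : I * 'I_(m n) :=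
  (sel p, inord (Num.truncn (d 1%g (x (sel p) * p.2)%g))).
have := @size_le_classes _ (I * 'I_(m n))%type color N s.
rewrite card_prod card_ord; apply => -[i q].
rewrite -size_filter; set t := seq.filter _ s.
have tP p : p \in t -> [/\ p \in s, sel p = i,
    (p.1 * x i * p.2)%g = g & Num.truncn (d 1%g (x i * p.2)%g) = q].
  rewrite mem_filter => /andP[/eqP[si qE] ps]; have [_ _ pg] := sF _ ps; split=> //.
    by rewrite -pg /Phi -si; case: (p).
  rewrite -qE inordK -?si //.
  have := posn _ ps; rewrite /m.
  have : (Num.truncn (d 1%g (x (sel p) * p.2)%g))%:R <= d 1%g (x (sel p) * p.2)%g.
    by rewrite truncn_le pdist_ge0.
  by move=> H1 H2; rewrite -(ltr_nat R); apply: le_lt_trans H1 H2.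
case tE : t => [//|p0 t'].
have p0t : p0 \in t by rewrite tE mem_head.
rewrite -tE -(size_map (fun p : G * G => p.1 * p0.1^-1)%g).
have [p0s sel0 g0 q0] := tP _ p0t.
apply: (acylN p0.1 (p0.1 * x i)%g).
- by rewrite -{1}(mulg1 p0.1) (pdistM hd).
- rewrite map_inj_in_uniq ?filter_uniq// => p p' /tP[_ _ pg _] /tP[_ _ pg' _] /mulIg E.
  have : p.2 = p'.2 by apply: (mulgI (p.1 * x i)%g); rewrite pg E pg'.
  by case: p p' E {pg pg'} => [? ?] [? ?] /= -> ->.
move=> w /mapP[p /tP[ps selp pg qp] ->].
rewrite mulgVK mulgA mulgVK.
have [A1 A2] := selP p; have [B1 B2] := selP p0; rewrite selp sel0 in A1 A2 B1 B2.
apply: (same_position_close (C := C) (L := 2 * C + 2 * delta + 1) (k := p0.2) (k' := p.2)) => //.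
- lra.
- by rewrite g0 pg.
have /andP[T1 T2] := truncn_itv (pdist_ge0 1%g (x i * p.2)%g).
have /andP[T3 T4] := truncn_itv (pdist_ge0 1%g (x i * p0.2)%g).
move: T1 T2 T3 T4; rewrite qp q0 -natr1 ler_norml; lra.
Qed.

End HyperbolicPseudometric.

(** * Orbits of an acylindrical action on a hyperbolic space *)
Section Orbit.
Set Implicit Arguments.
Unset Strict Implicit.
Unset Printing Implicit Defensive.
Local Open Scope ring_scope.
Local Open Scope card_scope.
Context {R : realType} {G : groupType} {Omega : metricType R}.
Context {act : G -> Omega -> Omega} (isom : isometric_action act).
Context {delta : R}.
Context (hyp : forall w x y z : Omega,
  Num.min (gromov_product w x y) (gromov_product w y z) - delta <= gromov_product w x z).

Definition orbit_dist (o : Omega) (g h : G) : R := mdist (act g o) (act h o).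

Lemma gromov_product_hyp (w x y z : Omega) :
  gromov_product w x y - delta <= gromov_product w x z \/
  gromov_product w y z - delta <= gromov_product w x z.
Proof. by have := hyp w x y z; rewrite minEle; case: ifP => _; [left|right]. Qed.

Lemma orbit_pseudometric o : hyperbolic_pseudometric (orbit_dist o) delta.
Proof.
have [_ actM actd] := isom; split; rewrite /orbit_dist.
- by move=> x; rewrite mdistxx.
- by move=> x y; rewrite metric_sym.
- by move=> x y z; exact: metric_triangle.
- by move=> g x y; rewrite !actM actd.
move=> w x y z; have := gromov_product_hyp (act w o) (act x o) (act y o) (act z o).
by rewrite /gromov_product; case=> H; [left|right]; lra.
Qed.

Lemma acylindrical_orbit o : acylindrical act -> orbit_acylindrical (d := orbit_dist o).
Proof.
have [_ actM _] := isom; move=> acyl eps.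
have [|r [N [_ _ HN]]] := acyl (Num.max 1 eps); first by rewrite lt_max ltr01.
exists r, N => x y xy s us sP.
apply: (card_le_uniq (HN _ _ xy) us) => g /sP[].
by rewrite /orbit_dist /= !actM !le_max => -> ->; rewrite !orbT.
Qed.

(** By [no_doubling_gprod] the geodesics from 1 to h and from 1 to g h agree past
    p, and |g h| = |h| up to a constant. The point g p is at distance t from
    g and |g h| - t from g h, so it lies on the second geodesic at distance about
    t from 1, as p does on the first. This needs points p between the orbit
    points, which is where geodesics enter. The bound is 6 (3 delta + 1) + 6 delta,
    where 3 delta + 1 is the loss in [no_doubling_gprod]. *)
Lemma geodesic_point_displacement o g h p t :
  (forall f, orbit_dist o 1%g (f * f)%g < orbit_dist o 1%g f + 4 * delta + 1) ->
  mdist (act 1%g o) p = t -> mdist p (act h o) = orbit_dist o 1%g h - t ->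
  orbit_dist o 1%g g <= t ->
  2 * t + orbit_dist o 1%g g + 2 * (3 * delta + 1) <= orbit_dist o 1%g h ->
  mdist p (act g p) <= 24 * delta + 6.
Proof.
move=> nodb Hp1 Hp2 gt th.
have hd := orbit_pseudometric o; have d0 := delta_ge0 hd.
have [_ actM actd] := isom.
have key := no_doubling_gprod hd nodb.
set a := orbit_dist o 1%g g in gt th *; set b := orbit_dist o 1%g h in Hp2 th *.
pose e := orbit_dist o 1%g (g * h)%g.
have a0 : 0 <= a := pdist_ge0 hd _ _.
have dgh : orbit_dist o g (g * h)%g = b by rewrite -{1}(mulg1 g) (pdistM hd).
have eb : b - a <= e.
  have := pdist_tri hd g 1%g (g * h)%g; rewrite dgh (pdistC hd g); rewrite -/a -/e; lra.
have e_le : e <= b + 2 * (3 * delta + 1).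
  have := key g^-1%g h; rewrite /gprod !(pdistC hd _ 1%g) (lenV hd) (pdist_len hd g^-1%g h)
    invgK -/a -/b -/e => H; have : a <= b by lra.
  by move=> /H; lra.
have e_ge : b <= e + 2 * (3 * delta + 1).
  have := key g (g * h)%g; rewrite /gprod dgh !(pdistC hd _ 1%g) -/a -/e => H.
  have : a <= e by lra.
  by move=> /H; lra.
have ghh : t <= gprod (d := orbit_dist o) 1%g (g * h)%g h.
  have [eh|/ltW he] := leP e b; first by have := key (g * h)%g h eh; rewrite -/e; lra.
  by rewrite (gprodC hd); have := key h (g * h)%g he; rewrite -/b; lra.
have P1 : mdist (act g o) (act g p) = t.
  by rewrite actd -Hp1; have [-> _ _] := isom.
have P2 : mdist (act g p) (act (g * h)%g o) = b - t by rewrite actM actd.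
have P3 : mdist (act 1%g o) (act (g * h)%g o) = e by [].
have P4 : mdist (act 1%g o) (act g o) = a by [].
have P5 : mdist (act g o) (act (g * h)%g o) = b by [].
have P6 : mdist (act 1%g o) (act h o) = b by [].
have ghh' : t <= gromov_product (act 1%g o) (act (g * h)%g o) (act h o) by [].
have L1 := metric_triangle (act 1%g o) (act g p) (act (g * h)%g o).
rewrite P2 P3 in L1.
have L2 : mdist (act 1%g o) (act g p) <= t + 2 * (3 * delta + 1) + 2 * delta.
  have := gromov_product_hyp (act 1%g o) (act g o) (act g p) (act (g * h)%g o).
  rewrite /gromov_product !(metric_sym _ (act 1%g o)) P1 P2 P3 P4 P5.
  by case; lra.
have S1 : t - 2 * (3 * delta + 1) <= gromov_product (act 1%g o) (act g p) (act (g * h)%g o).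
  by rewrite /gromov_product !(metric_sym _ (act 1%g o)) P2 P3; lra.
have S2 : gromov_product (act 1%g o) (act h o) p = t.
  rewrite /gromov_product !(metric_sym _ (act 1%g o)) (metric_sym (act h o) p).
  by rewrite Hp1 Hp2 P6; lra.
have : mdist p (act g p) = mdist (act 1%g o) (act g p) + t -
    2 * gromov_product (act 1%g o) (act g p) p.
  by rewrite /gromov_product !(metric_sym _ (act 1%g o)) Hp1 (metric_sym p); lra.
case: (gromov_product_hyp (act 1%g o) (act g p) (act (g * h)%g o) (act h o));
case: (gromov_product_hyp (act 1%g o) (act g p) (act h o) p); lra.
Qed.

Lemma unbounded_uniq (o : Omega) n : (forall M, exists g, M < orbit_dist o 1%g g) ->
  exists (s : seq G) M, [/\ uniq s, size s = n & forall g, g \in s -> orbit_dist o 1%g g <= M].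
Proof.
move=> unb; elim: n => [|n [s [M [us sn sM]]]]; first by exists [::], 0.
have [g Mg] := unb M; exists (g :: s), (orbit_dist o 1%g g); split.
- by rewrite /= us andbT; apply/negP => /sM; rewrite leNgt Mg.
- by rewrite /= sn.
by move=> f; rewrite inE => /predU1P[->//|/sM fM]; lra.
Qed.

(** Otherwise N + 1 elements of length at most M displace both points at
    distances M and M + r from 1 on a geodesic to a far orbit point by a
    constant depending on delta only, against acylindricity. *)
Lemma exists_doubling o : geodesic_space Omega -> acylindrical act ->
  (forall M, exists g, M < orbit_dist o 1%g g) ->
  exists f, orbit_dist o 1%g f + 4 * delta + 1 <= orbit_dist o 1%g (f * f)%g.
Proof.
move=> geo acyl unb; apply: contrapT => no.
have nodb f : orbit_dist o 1%g (f * f)%g < orbit_dist o 1%g f + 4 * delta + 1.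
  by rewrite ltNge; apply/negP => H; apply: no; exists f.
have hd := orbit_pseudometric o; have d0 := delta_ge0 hd.
have [|r [N [r0 _ HN]]] := acyl (24 * delta + 6); first by lra.
have [s [M0 [us sN sM]]] := unbounded_uniq N.+1 unb.
pose M := Num.max 0 M0.
have M00 : 0 <= M by rewrite le_max lexx.
have sM' g : g \in s -> orbit_dist o 1%g g <= M.
  by move=> /sM H; rewrite le_max H orbT.
have [h Hh] := unb (2 * (M + r) + M + 2 * (3 * delta + 1)).
have [gam [g0 gh gd]] := geo (act 1%g o) (act h o).
have hE : mdist (act 1%g o) (act h o) = orbit_dist o 1%g h by [].
rewrite hE in gh gd.
have pt t : M <= t <= M + r -> forall g, g \in s ->
    mdist (gam t) (act g (gam t)) <= 24 * delta + 6.
  move=> /andP[Mt tM] g /sM' gM.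
  have tr : 0 <= t <= orbit_dist o 1%g h by lra.
  have zr : 0 <= (0 : R) <= orbit_dist o 1%g h by lra.
  have hr : 0 <= orbit_dist o 1%g h <= orbit_dist o 1%g h by lra.
  apply: (geodesic_point_displacement nodb (h := h) (t := t)); last 2 first.
  - lra.
  - lra.
  - by rewrite -g0 gd// sub0r normrN ger0_norm; lra.
  by rewrite -{1}gh gd// distrC ger0_norm; lra.
have rd : r <= mdist (gam M) (gam (M + r)).
  rewrite gd; [|lra|lra]; rewrite opprD addNKr normrN ger0_norm ?lexx//; exact: ltW.
have := card_le_uniq (HN _ _ rd) us; rewrite sN ltnn => H.
suff : false by []; apply: H => g gs /=; split; apply: pt => //; lra.
Qed.

Lemma axial_loxodromic o A f :
  axial (d := orbit_dist o) A f -> loxodromic act f.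
Proof.
move=> [growth _]; exists o; have hd := orbit_pseudometric o.
exists (Num.max 1 (orbit_dist o 1%g f)), 0; split=> [||m n]; rewrite ?le_max ?lexx//.
set lambda := Num.max _ _.
have l1 : 1 <= lambda by rewrite le_max lexx.
have lf : orbit_dist o 1%g f <= lambda by rewrite le_max lexx orbT.
have l0 : 0 < lambda by lra.
rewrite -[mdist _ _]/(orbit_dist o (expgz f m) (expgz f n)) (pdist_expgz hd).
have -> : `|m - n|%:~R = (`|m - n|%N)%:R :> R by rewrite -abszE pmulrn.
set k := `|m - n|%N; rewrite subr0 addr0; apply/andP; split.
  apply: le_trans (growth k); rewrite ler_piMl ?ler0n// invf_le1//.
apply: le_trans (len_expg_le hd f k) _.
by rewrite mulrC ler_wpM2r ?ler0n.
Qed.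
End Orbit.

(** * Linearly bounded ambiguity *)
Theorem corollary5p11 (R : realType) (G : groupType) (X : set G)
    (finX : finite_set X) (genX : generates X)
    (hypG : acylindrically_hyperbolic R G) :
  exists f : nat -> nat, ambiguity_function X f /\ linearly_bounded R f.
Proof.
have [Y [act [[geo [delta hyp]] isom acyl nonel]]] := hypG.
have [x0 unb] : exists o, forall M : R, exists g, (M < orbit_dist (act := act) o 1%g g)%R.
  apply: contrapT => no; apply: nonel; left => o; apply: contrapT => nobd.
  apply: no; exists o => M; apply: contrapT => no; apply: nobd; exists M => g h.
  rewrite -[mdist _ _]/(orbit_dist (act := act) o g h).
  rewrite (pdist_len (orbit_pseudometric isom hyp o)) leNgt.
  by apply/negP => H; apply: no; exists (g^-1 * h)%g.
have hd := orbit_pseudometric isom hyp x0.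
have [f /(doubling_axial hd) axf] := exists_doubling isom hyp geo acyl unb.
have nvc : ~ virtually_cyclic G.
  move=> vc; apply: nonel; right; split=> //; exists f.
  exact: (axial_loxodromic isom hyp axf).
have oacyl := acylindrical_orbit isom x0 acyl.
have [C conn] := three_connectors hd oacyl nvc (ex_intro _ _ (ex_intro _ _ axf)).
exact: (connectors_linear_ambiguity hd finX genX oacyl conn).
Qed.
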